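(* Let $(L,\triangle,\nabla)$ be an m-lattice and $(X(L),E_\nabla)$ its associated mq-space. Then the lattice $\mathcal{C}_{idS}(X(L))$ of closed $id$-saturated subsets of $X(L)$ is isomorphic to the dual of the lattice $Con_M(L)$ of m-congruences of $L$ (lattice congruences compatible with $\triangle$ and $\nabla$), the isomorphism being $Y\mapsto \Theta_M(Y)=\{(a,b)\in L\times L:\ \sigma_L(a)\cap Y=\sigma_L(b)\cap Y\}$.
   Context: An m-lattice is $(L,\triangle,\nabla)$ with $L$ a bounded distributive lattice and unary operations satisfying $\nabla 0=0$, $x\wedge\nabla x=x$, $\nabla(x\wedge\nabla y)=\nabla x\wedge\nabla y$, $\nabla(x\vee y)=\nabla x\vee\nabla y$, $\nabla\nabla x=\nabla x$, $\triangle 1=1$, $x\wedge\triangle x=\triangle x$, $\triangle(x\wedge y)=\triangle x\wedge\triangle y$, $\triangle\triangle x=\triangle x$, $\nabla\triangle x=\triangle x$, $\triangle\nabla x=\nabla x$. $X(L)$ is the set of prime filters of $L$ ordered by inclusion with the Priestley topology (subbasis: the sets $\sigma_L(a)=\{P\in X(L): a\in P\}$ and their complements). $E_\nabla=\{(P,T)\in X(L)^2: P\cap\nabla(L)=T\cap\nabla(L)\}$. For a relation $E$, $E(Z)=\{y:(x,y)\in E$ for some $x\in Z\}$, $E(x)=E(\{x\})$; $[x)=\{y:x\le y\}$; $\max Z$, $\min Z$ are the maximal and minimal elements of $Z$. A subset $Y$ of $X(L)$ is $id$-saturated if $\min E_\nabla([y))\cup\max E_\nabla(y)\subseteq Y$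 for all $y\in Y$; closed means closed in the Priestley topology. *)

(* Defs.v *)
From HB Require Import structures.
From mathcomp Require Import all_boot all_order.
From mathcomp Require Import boolp classical_sets topology.

Set Implicit Arguments.
Unset Strict Implicit.
Unset Printing Implicit Defensive.

Import Order.TTheory.

Local Open Scope order_scope.
Local Open Scope classical_set_scope.

HB.mixin Record TBDistrLattice_isMLattice (d : Order.disp_t) (L : Type)
    & Order.TBDistrLattice d L := {
  triangle : L -> L;
  nabla : L -> L;
  nabla0 : nabla \bot = \bot;
  meet_nabla : forall x, Order.meet x (nabla x) = x;
  nablaI : forall x y,
    nabla (Order.meet x (nabla y)) = Order.meet (nabla x) (nabla y);
  nablaU : forall x y,
    nabla (Order.join x y) = Order.join (nabla x) (nabla y);
  nabla_nabla : forall x, nabla (nabla x) = nabla x;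
  triangle1 : triangle \top = \top;
  meet_triangle : forall x, Order.meet x (triangle x) = triangle x;
  triangleI : forall x y,
    triangle (Order.meet x y) = Order.meet (triangle x) (triangle y);
  triangle_triangle : forall x, triangle (triangle x) = triangle x;
  nabla_triangle : forall x, nabla (triangle x) = triangle x;
  triangle_nabla : forall x, triangle (nabla x) = nabla x
}.

#[short(type="mLatticeType")]
HB.structure Definition MLattice (d : Order.disp_t) :=
  { L of Order.TBDistrLattice d L & TBDistrLattice_isMLattice d L }.

Section PrimeFilters.
Context {d : Order.disp_t} (L : tbDistrLatticeType d).

(* Prime filters are proper; with [P \top] this also makes them nonempty. *)
Definition is_prime_filter (P : set L) : Prop :=
  [/\ P \top, ~ P \bot,
      forall a b, P a -> a <= b -> P b,
      forall a b, P a -> P b -> P (Order.meet a b)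
    & forall a b, P (Order.join a b) -> P a \/ P b].

Record primeFilter : Type := PrimeFilter {
  pf_set :> set L;
  pf_prime : is_prime_filter pf_set
}.

Lemma primeFilter_inj (P Q : primeFilter) : pf_set P = pf_set Q -> P = Q.
Proof.
case: P Q => [P hP] [Q hQ] /= PQ; subst Q.
by rewrite (Prop_irrelevance hP hQ).
Qed.

HB.instance Definition _ := gen_eqMixin primeFilter.
HB.instance Definition _ := gen_choiceMixin primeFilter.

Definition pf_le (P Q : primeFilter) : bool := `[< pf_set P `<=` pf_set Q >].

Fact pf_le_refl : reflexive pf_le.
Proof. by move=> P; apply/asboolP. Qed.

Fact pf_le_anti : antisymmetric pf_le.
Proof.
move=> P Q /andP[/asboolP PQ /asboolP QP].
by apply: primeFilter_inj; apply/seteqP.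
Qed.

Fact pf_le_trans : transitive pf_le.
Proof.
move=> Q P T /asboolP PQ /asboolP QT; apply/asboolP.
exact: subset_trans PQ QT.
Qed.

HB.instance Definition _ := Order.Le_isPOrder.Build (Order.Disp tt tt)
  primeFilter pf_le_refl pf_le_anti pf_le_trans.

Definition sigma (a : L) : set primeFilter := [set P | pf_set P a].

Definition priestley_subbase : set (set primeFilter) :=
  [set U | exists a : L, U = sigma a \/ U = ~` sigma a].

HB.instance Definition _ :=
  @isSubBaseTopological.Build primeFilter (set primeFilter)
    priestley_subbase id.

End PrimeFilters.

Definition rel_img (T : Type) (E : set (T * T)) (Z : set T) : set T :=
  [set y | exists2 x, Z x & E (x, y)].

Section Extremal.
Context {d : Order.disp_t} {T : porderType d}.
Implicit Type Z : set T.

Definition upset (x : T) : set T := [set y | x <= y].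

Definition max_elts Z : set T :=
  [set x | Z x /\ forall y, Z y -> x <= y -> y = x].

Definition min_elts Z : set T :=
  [set x | Z x /\ forall y, Z y -> y <= x -> y = x].

End Extremal.

Section MSpace.
Context {d : Order.disp_t} (L : mLatticeType d).
Local Notation X := (primeFilter L).

Definition E_nabla : set (X * X) :=
  [set PT | pf_set PT.1 `&` range (@nabla d L)
          = pf_set PT.2 `&` range (@nabla d L)].

Definition id_saturated (Y : set X) : Prop :=
  forall y, Y y ->
    min_elts (rel_img E_nabla (upset y))
      `|` max_elts (rel_img E_nabla [set y]) `<=` Y.

Definition Theta_M (Y : set X) : set (L * L) :=
  [set ab | sigma ab.1 `&` Y = sigma ab.2 `&` Y].

Definition is_m_congruence (R : set (L * L)) : Prop :=
  [/\ [/\ forall a, R (a, a),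
          forall a b, R (a, b) -> R (b, a)
        & forall a b c, R (a, b) -> R (b, c) -> R (a, c)],
      forall a b a' b', R (a, b) -> R (a', b') ->
        R (Order.meet a a', Order.meet b b'),
      forall a b a' b', R (a, b) -> R (a', b') ->
        R (Order.join a a', Order.join b b'),
      forall a b, R (a, b) -> R (triangle a, triangle b)
    & forall a b, R (a, b) -> R (nabla a, nabla b)].

Record closedIdSat : Type := ClosedIdSat {
  cis_set :> set X;
  cis_prop : closed cis_set /\ id_saturated cis_set
}.

Record mCongruence : Type := MCongruence {
  mcong_set :> set (L * L);
  mcong_prop : is_m_congruence mcong_set
}.

Lemma closedIdSat_inj (Y Z : closedIdSat) : cis_set Y = cis_set Z -> Y = Z.
Proof.
case: Y Z => [Y hY] [Z hZ] /= YZ; subst Z.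
by rewrite (Prop_irrelevance hY hZ).
Qed.

Lemma mCongruence_inj (R S : mCongruence) : mcong_set R = mcong_set S -> R = S.
Proof.
case: R S => [R hR] [S hS] /= RS; subst S.
by rewrite (Prop_irrelevance hR hS).
Qed.

HB.instance Definition _ := gen_eqMixin closedIdSat.
HB.instance Definition _ := gen_choiceMixin closedIdSat.
HB.instance Definition _ := gen_eqMixin mCongruence.
HB.instance Definition _ := gen_choiceMixin mCongruence.

Definition cis_le (Y Z : closedIdSat) : bool :=
  `[< cis_set Y `<=` cis_set Z >].

Fact cis_le_refl : reflexive cis_le.
Proof. by move=> Y; apply/asboolP. Qed.

Fact cis_le_anti : antisymmetric cis_le.
Proof.
move=> Y Z /andP[/asboolP YZ /asboolP ZY].
by apply: closedIdSat_inj; apply/seteqP.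
Qed.

Fact cis_le_trans : transitive cis_le.
Proof.
move=> Z Y W /asboolP YZ /asboolP ZW; apply/asboolP.
exact: subset_trans YZ ZW.
Qed.

HB.instance Definition _ := Order.Le_isPOrder.Build (Order.Disp tt tt)
  closedIdSat cis_le_refl cis_le_anti cis_le_trans.

Fact cis_meet_prop (Y Z : closedIdSat) :
  closed (cis_set Y `&` cis_set Z) /\ id_saturated (cis_set Y `&` cis_set Z).
Proof.
case: Y Z => [Y [cY sY]] [Z [cZ sZ]] /=; split; first exact: closedI.
by move=> y [Yy Zy] z zE; split; [apply: sY zE | apply: sZ zE].
Qed.

Fact cis_join_prop (Y Z : closedIdSat) :
  closed (cis_set Y `|` cis_set Z) /\ id_saturated (cis_set Y `|` cis_set Z).
Proof.
case: Y Z => [Y [cY sY]] [Z [cZ sZ]] /=; split; first exact: closedU.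
by move=> y [Yy|Zy] z zE; [left; apply: sY zE | right; apply: sZ zE].
Qed.

Definition cis_meet (Y Z : closedIdSat) := ClosedIdSat (cis_meet_prop Y Z).
Definition cis_join (Y Z : closedIdSat) := ClosedIdSat (cis_join_prop Y Z).

Fact cis_meetP (Y Z W : closedIdSat) :
  (Y <= cis_meet Z W) = (Y <= Z) && (Y <= W).
Proof.
apply/asboolP/andP => [|[/asboolP YZ /asboolP YW]].
  by rewrite subsetI => -[YZ YW]; split; apply/asboolP.
by rewrite subsetI.
Qed.

Fact cis_joinP (Y Z W : closedIdSat) :
  (cis_join Y Z <= W) = (Y <= W) && (Z <= W).
Proof.
apply/asboolP/andP => [|[/asboolP YW /asboolP ZW]].
  by rewrite subUset => -[YW ZW]; split; apply/asboolP.
by rewrite subUset.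
Qed.

HB.instance Definition _ := Order.POrder_MeetJoin_isLattice.Build
  (Order.Disp tt tt) closedIdSat cis_meetP cis_joinP.

Definition mcong_le (R S : mCongruence) : bool :=
  `[< mcong_set R `<=` mcong_set S >].

Fact mcong_le_refl : reflexive mcong_le.
Proof. by move=> R; apply/asboolP. Qed.

Fact mcong_le_anti : antisymmetric mcong_le.
Proof.
move=> R S /andP[/asboolP RS /asboolP SR].
by apply: mCongruence_inj; apply/seteqP.
Qed.

Fact mcong_le_trans : transitive mcong_le.
Proof.
move=> S R T /asboolP RS /asboolP ST; apply/asboolP.
exact: subset_trans RS ST.
Qed.

HB.instance Definition _ := Order.Le_isPOrder.Build (Order.Disp tt tt)
  mCongruence mcong_le_refl mcong_le_anti mcong_le_trans.

Fact mcong_bigcap_prop (F : set (set (L * L))) :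
  (forall R, F R -> is_m_congruence R) ->
  is_m_congruence (\bigcap_(R in F) R).
Proof.
move=> FP; split; [split| | | |].
- by move=> a R FR; have [[rR _ _] _ _ _ _] := FP _ FR; apply: rR.
- move=> a b ab R FR; have [[_ sR _] _ _ _ _] := FP _ FR.
  exact: sR (ab _ FR).
- move=> a b c ab bc R FR; have [[_ _ tR] _ _ _ _] := FP _ FR.
  exact: tR (ab _ FR) (bc _ FR).
- move=> a b a' b' ab ab' R FR; have [_ mR _ _ _] := FP _ FR.
  exact: mR (ab _ FR) (ab' _ FR).
- move=> a b a' b' ab ab' R FR; have [_ _ jR _ _] := FP _ FR.
  exact: jR (ab _ FR) (ab' _ FR).
- move=> a b ab R FR; have [_ _ _ tR _] := FP _ FR.
  exact: tR (ab _ FR).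
- move=> a b ab R FR; have [_ _ _ _ nR] := FP _ FR.
  exact: nR (ab _ FR).
Qed.

Fact mcong_meet_prop (R S : mCongruence) :
  is_m_congruence (mcong_set R `&` mcong_set S).
Proof.
have -> : mcong_set R `&` mcong_set S
    = \bigcap_(T in [set mcong_set R; mcong_set S]) T.
  apply/seteqP; split=> [ab [Rab Sab] T [->|->]//|ab h].
  by split; apply: h; [left|right].
by apply: mcong_bigcap_prop => T [->|->]; apply: mcong_prop.
Qed.

(* The m-congruence generated by the union of R and S. *)
Fact mcong_join_prop (R S : mCongruence) :
  is_m_congruence (\bigcap_(T in [set T : set (L * L) |
    is_m_congruence T /\ mcong_set R `|` mcong_set S `<=` T]) T).
Proof. by apply: mcong_bigcap_prop => T []. Qed.

Definition mcong_meet (R S : mCongruence) := MCongruence (mcong_meet_prop R S).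
Definition mcong_join (R S : mCongruence) := MCongruence (mcong_join_prop R S).

Fact mcong_meetP (R S T : mCongruence) :
  (R <= mcong_meet S T) = (R <= S) && (R <= T).
Proof.
apply/asboolP/andP => [|[/asboolP RS /asboolP RT]].
  by rewrite subsetI => -[RS RT]; split; apply/asboolP.
by rewrite subsetI.
Qed.

Fact mcong_joinP (R S T : mCongruence) :
  (mcong_join R S <= T) = (R <= T) && (S <= T).
Proof.
apply/asboolP/andP => [RST|[/asboolP RT /asboolP ST]].
  by split; apply/asboolP => ab abR; apply: RST => U [_]; apply; [left|right].
move=> ab; apply; split; first exact: mcong_prop.
by rewrite subUset.
Qed.

HB.instance Definition _ := Order.POrder_MeetJoin_isLattice.Build
  (Order.Disp tt tt) mCongruence mcong_meetP mcong_joinP.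

End MSpace.

(* Main.v *)
(** Write K for the common image of [nabla] and [triangle]: [nabla x] is the
    least element of K above [x] and [triangle x] the greatest one below.  So
    for a prime filter P the filter generated by the trace of P on K is
    [{x | P (triangle x)}], and the ideal generated by the elements of K
    outside P is [{x | ~ P (nabla x)}].  The prime filter theorem applied to
    these shows that [nabla a] lies in P iff [a] lies in some maximal element
    of E(P), and [triangle a] lies in P iff [a] lies in every minimal element
    of E([P)).  Hence Theta(Y) is compatible with both operations as soon as Y
    is id-saturated.  Conversely, if Y is closed and Q is not in Y, some pair
    (a, b) satisfies a in Q, b not in Q, and every P in Y containing a contains
    b; when Q is extremal for some y in Y, this pair can be modified by an
    element witnessing extremality so that its image under [nabla] or
    [triangle] is separated by y, contradicting compatibility.  The inverse of
    Theta sends a congruence R to the set of prime filters stable under R. *)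

Require Import Defs.
From HB Require Import structures.
From mathcomp Require Import all_boot all_order.
From mathcomp Require Import finmap boolp classical_sets filter topology.

Set Implicit Arguments.
Unset Strict Implicit.
Unset Printing Implicit Defensive.

Import Order.TTheory.

Local Open Scope classical_set_scope.
Local Open Scope order_scope.

(** * Order isomorphisms between lattices *)

Section OrderIsomorphisms.
Context {d d' : Order.disp_t} {A : latticeType d} {B : latticeType d'}.
Context (f : A -> B).
Hypotheses (fbij : bijective f) (fle : {mono f : x y / x <= y}).

Lemma bij_mono_morph_meet : {morph f : x y / x `&` y}.
Proof.
have [g fK gK] := fbij => x y; apply/le_anti.
rewrite lexI !fle leIl leIr /= -[f x `&` f y]gK fle lexI -!fle gK.
by rewrite leIl leIr.
Qed.

Lemma bij_mono_morph_join : {morph f : x y / x `|` y}.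
Proof.
have [g fK gK] := fbij => x y; apply/le_anti.
rewrite leUx !fle leUl leUr /= andbT -[f x `|` f y]gK fle leUx -!fle gK.
by rewrite leUl leUr.
Qed.

End OrderIsomorphisms.

(** * Separating filters from ideals by prime filters *)

Section Separation.
Context {d : Order.disp_t} {L : tbDistrLatticeType d}.
Implicit Types (F I G : set L) (a b x y : L).

Definition lattice_filter F : Prop :=
  [/\ F \top, forall a b, F a -> a <= b -> F b
    & forall a b, F a -> F b -> F (a `&` b)].

Definition lattice_ideal I : Prop :=
  [/\ I \bot, forall a b, I b -> a <= b -> I a
    & forall a b, I a -> I b -> I (a `|` b)].

Definition filter_join F G : set L :=
  [set x | exists a b, [/\ F a, G b & a `&` b <= x]].

Lemma filter_join_filter F G :
  lattice_filter F -> lattice_filter G -> lattice_filter (filter_join F G).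
Proof.
move=> [F1 Fup FI] [G1 Gup GI]; split.
- by exists \top, \top; rewrite lex1.
- by move=> x y [a [b [Fa Gb abx]]] xy; exists a, b; rewrite (le_trans abx).
- move=> x y [a [b [Fa Gb abx]]] [a' [b' [Fa' Gb' abx']]].
  exists (a `&` a'), (b `&` b'); split; [exact: FI | exact: GI |].
  by rewrite meetACA leI2.
Qed.

Lemma filter_join_subl F G : lattice_filter G -> F `<=` filter_join F G.
Proof. by move=> [G1 _ _] x Fx; exists x, \top; rewrite meetx1. Qed.

Lemma filter_join_subr F G : lattice_filter F -> G `<=` filter_join F G.
Proof. by move=> [F1 _ _] x Gx; exists \top, x; rewrite meet1x. Qed.

Lemma principal_filter a : lattice_filter [set x | a <= x].
Proof.
split=> [|x y /= ax xy|x y /= ax ay]; first exact: lex1.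
- exact: le_trans xy.
- by rewrite lexI ax.
Qed.

Lemma principal_ideal a : lattice_ideal [set x | x <= a].
Proof.
split=> [|x y /= ya xy|x y /= xa ya]; first exact: le0x.
- exact: le_trans ya.
- by rewrite leUx xa.
Qed.

Section PrimeFilterTheory.
Variable P : primeFilter L.

Lemma pf1 : pf_set P \top. Proof. by have [] := pf_prime P. Qed.

Lemma pf0 : ~ pf_set P \bot. Proof. by have [] := pf_prime P. Qed.

Lemma pfW a b : a <= b -> pf_set P a -> pf_set P b.
Proof. by move=> ab Pa; have [_ _ up _ _] := pf_prime P; apply: up ab. Qed.

Lemma pfI a b : pf_set P (a `&` b) <-> pf_set P a /\ pf_set P b.
Proof.
split=> [Pab|[Pa Pb]]; last by have [_ _ _ h _] := pf_prime P; apply: h.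
by split; apply: pfW Pab; rewrite ?leIl ?leIr.
Qed.

Lemma pfU a b : pf_set P (a `|` b) <-> pf_set P a \/ pf_set P b.
Proof.
split=> [|[]]; first by have [_ _ _ _] := pf_prime P; apply.
- by apply: pfW; rewrite leUl.
- by apply: pfW; rewrite leUr.
Qed.

Lemma pf_filter : lattice_filter P.
Proof. by have [] := pf_prime P. Qed.

End PrimeFilterTheory.

Lemma pf_leP (P Q : primeFilter L) :
  reflect (pf_set P `<=` pf_set Q) (P <= Q).
Proof. exact: asboolP. Qed.

(** The last clause is Zorn maximality in usable form: otherwise the filter generated by [P] and [x]
    would still avoid [I]. Primeness and the later maximality arguments are drawn from it. *)
Lemma maximal_prime_filter F I : lattice_filter F -> lattice_ideal I ->
  (forall x, F x -> ~ I x) ->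
  exists P : primeFilter L,
    [/\ F `<=` pf_set P, forall x, pf_set P x -> ~ I x
      & forall x, ~ pf_set P x -> exists2 p, pf_set P p & I (p `&` x)].
Proof.
move=> FF II FI0; have [I0 Idown IU] := II.
(* [Zorn_bigcup] needs a property that holds of the empty set, whence the
   union with [F]. *)
pose ok G := lattice_filter (F `|` G)%classic /\
             forall x, (F `|` G)%classic x -> ~ I x.
have [|A [[fA A0] Amax]] := @Zorn_bigcup L ok.
  move=> C Cok Ctot; split; last first.
    by move=> x [/FI0//|[G /Cok[_ h] Gx]]; apply: h; right.
  have [F1 Fup FFI] := FF; split; first by left.
    move=> a b [Fa|[G CG Ga]] ab; first by left; apply: Fup ab.
    have [[_ up _] _] := Cok _ CG.
    by have [|?|?] := up a b _ ab; [right|left|right; exists G].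
  have one G a b : C G -> (F `|` G)%classic a -> (F `|` G)%classic b ->
      (F `|` \bigcup_(X in C) X)%classic (a `&` b).
    move=> CG Ga Gb; have [[_ _ GI] _] := Cok _ CG.
    by have [?|?] := GI _ _ Ga Gb; [left|right; exists G].
  move=> a b [Fa|[G CG Ga]] [Fb|[H CH Hb]].
  - by left; apply: FFI.
  - by apply: (one H) => //; [left|right].
  - by apply: (one G) => //; [right|left].
  - have [GH|HG] := Ctot _ _ CG CH.
    + by apply: (one H) => //; right => //; apply: GH.
    + by apply: (one G) => //; right => //; apply: HG.
pose P := (F `|` A)%classic.
have Pmax x : ~ P x -> exists2 p, P p & I (p `&` x).
  move=> nPx; apply: contrapT => nex.
  pose G := filter_join P [set y | x <= y].
  have FG : lattice_filter G := filter_join_filter fA (principal_filter x).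
  have PG : P `<=` G := filter_join_subl (principal_filter x).
  have Gx : G x by apply: filter_join_subr fA _ _; apply: lexx.
  apply: (Amax G); first split.
  - by move=> y Ay; apply: PG; right.
  - by move=> GA; apply: nPx; right; apply: GA.
  - have -> : ok G = (lattice_filter G /\ forall x, G x -> ~ I x).
      by rewrite /ok setUidr // => y Fy; apply: PG; left.
    split=> // y [p [q [Pp xq pqy]]] Iy; apply: nex; exists p => //.
    by apply: Idown Iy _; apply: le_trans pqy; rewrite leI2.
have [P1 Pup PI] := fA.
suff pP : is_prime_filter P.
  by exists (PrimeFilter pP); split=> //= x Fx; left.
split=> // [/A0//|a b Pab].
apply: contrapT => /not_orP[/Pmax[p Pp Ipa] /Pmax[q Pq Iqb]].
(* Distributivity puts this element of [P] below the join of the elements of [I] in [Ipa] and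
   [Iqb]. *)
apply: (A0 ((p `&` q) `&` (a `|` b))); first exact/PI/Pab/PI.
apply: Idown (IU _ _ Ipa Iqb) _.
by rewrite meetUr leU2 // leI2 // ?leIl ?leIr.
Qed.

End Separation.

(* Order dual of [maximal_prime_filter]: prime filters of the dual lattice are
   the complements of prime filters. *)
Lemma minimal_prime_filter (d : Order.disp_t) (L : tbDistrLatticeType d)
    (F I : set L) :
  lattice_filter F -> lattice_ideal I -> (forall x, F x -> ~ I x) ->
  exists P : primeFilter L,
    [/\ F `<=` pf_set P, forall x, pf_set P x -> ~ I x
      & forall x, pf_set P x -> exists2 r, ~ pf_set P r & F (r `|` x)].
Proof.
move=> [F1 Fup FI] [I0 Idown IU] FI0.
have [||x Ix Fx|Q [IQ Q0 Qmax]] := @maximal_prime_filter _ (L^d)%type I F.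
- by split=> // a b Ia ab; apply: Idown ab.
- by split=> // a b Fb ab; apply: Fup ab.
- exact: FI0 Fx Ix.
have pP : is_prime_filter (fun x : L => ~ pf_set Q x).
  split.
  - exact: (@pf0 _ _ Q).
  - by apply; apply: (@pf1 _ _ Q).
  - by move=> a b nQa ab Qb; apply: nQa; apply: (@pfW _ _ Q) Qb.
  - by move=> a b nQa nQb /(@pfU _ _ Q)[].
  - move=> a b nQab; apply: contrapT => /not_orP[/contrapT Qa /contrapT Qb].
    by apply: nQab; apply/(@pfI _ _ Q).
exists (PrimeFilter pP); split=> /= [x Fx Qx|x nQx Ix|x /Qmax[r Qr Frx]].
- exact: Q0 Fx.
- by apply: nQx; apply: IQ.
- by exists r.
Qed.

(** * Separation in the Priestley topology *)

Section Priestley.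
Context {d : Order.disp_t} {L : tbDistrLatticeType d}.
Local Notation X := (primeFilter L).

(** Conditions [sigma c] accumulate by meets into [a], complemented ones by joins into [b]. *)
Lemma priestley_base (s : seq (set X)) (Q : X) :
  (forall U, U \in s -> priestley_subbase U) -> (forall U, U \in s -> U Q) ->
  exists a b, [/\ pf_set Q a, ~ pf_set Q b
    & forall P : X, pf_set P a -> ~ pf_set P b ->
        forall U, U \in s -> U P].
Proof.
elim: s => [|V s IHs] sub sQ.
  by exists \top, \bot; split=> //; [exact: pf1 | exact: pf0].
have [U Us|U Us|a [b [Qa nQb abs]]] := IHs.
- by apply: sub; rewrite inE Us orbT.
- by apply: sQ; rewrite inE Us orbT.
have VQ : V Q by apply: sQ; rewrite inE eqxx.
have [|c [Vc|Vc]] := sub V; first by rewrite inE eqxx.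
- exists (a `&` c), b; split=> //; first by apply/pfI; rewrite Vc in VQ.
  move=> P /pfI[Pa Pc] nPb U; rewrite inE => /predU1P[->|]; last exact: abs.
  by rewrite Vc.
- exists a, (b `|` c); split=> //; first by rewrite Vc in VQ; move=> /pfU[].
  move=> P Pa nPbc U; rewrite inE => /predU1P[->|].
    by rewrite Vc => Pc; apply: nPbc; apply/pfU; right.
  by apply: abs => // Pb; apply: nPbc; apply/pfU; left.
Qed.

Lemma priestley_openE (U : set X) : open U =
  exists2 D, D `<=` finI_from (@priestley_subbase d L) id
    & \bigcup_(A in D) A = U.
Proof. by []. Qed.

Lemma closed_separation (Y : set X) (Q : X) : closed Y -> ~ Y Q ->
  exists a b, [/\ pf_set Q a, ~ pf_set Q b
    & forall P : X, Y P -> pf_set P a -> pf_set P b].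
Proof.
rewrite -openC priestley_openE => -[D Dsub DY] nYQ.
have : (~` Y)%classic Q by [].
rewrite -DY => -[B DB]; have [S Ssub SB] := Dsub _ DB; rewrite -SB => SQ.
have [U /Ssub||a [b [Qa nQb abS]]] := @priestley_base (enum_fset S) Q.
- by rewrite inE.
- exact: SQ.
exists a, b; split=> // P YP Pa; apply: contrapT => nPb.
have : (~` Y)%classic P; last by [].
by rewrite -DY; exists B => //; rewrite -SB => U; apply: abS.
Qed.

Lemma priestley_subbase_open (U : set X) : priestley_subbase U -> open U.
Proof.
move=> DU; rewrite priestley_openE; exists [set U]; last exact: bigcup_set1.
by move=> _ ->; exact: (@finI_from1 _ _ (@priestley_subbase d L) id).
Qed.

Lemma closed_sigma (a : L) : closed (sigma a).
Proof.
by rewrite -openC; apply: priestley_subbase_open; exists a; right.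
Qed.

Lemma closed_sigmaC (a : L) : closed (~` sigma a)%classic.
Proof.
by apply: open_closedC; apply: priestley_subbase_open; exists a; left.
Qed.

End Priestley.

(** * Prime filters extremal for [E_nabla] *)

Section MLatticeTheory.
Context {d : Order.disp_t} {L : mLatticeType d}.
Local Notation X := (primeFilter L).
Implicit Types (x y a b : L) (P Q T : X).

Lemma nabla_ge x : x <= nabla x.
Proof. by apply/meet_idPl; rewrite meet_nabla. Qed.

Lemma triangle_le x : triangle x <= x.
Proof. by apply/meet_idPr; rewrite meet_triangle. Qed.

Lemma nabla_mono : {homo @nabla d L : x y / x <= y}.
Proof. by move=> x y /join_idPr <-; rewrite nablaU leUl. Qed.

Lemma triangle_mono : {homo @triangle d L : x y / x <= y}.
Proof. by move=> x y /meet_idPl <-; rewrite triangleI leIr. Qed.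

Lemma nabla_meet_triangle x y :
  nabla (x `&` triangle y) = nabla x `&` triangle y.
Proof. by rewrite -[triangle y]nabla_triangle nablaI. Qed.

Lemma triangle_filter P : lattice_filter [set x | pf_set P (triangle x)].
Proof.
split=> [|a b /= Pa ab|a b /= Pa Pb]; first by rewrite /= triangle1; apply: pf1.
- by apply: pfW Pa; apply: triangle_mono.
- by rewrite triangleI; apply/pfI.
Qed.

Lemma nabla_ideal P : lattice_ideal [set x | ~ pf_set P (nabla x)].
Proof.
split=> [|a b /= nPb ab Pa|a b /= nPa nPb].
- by rewrite /= nabla0; apply: pf0.
- by apply: nPb; apply: pfW Pa; apply: nabla_mono.
- by rewrite nablaU => /pfU[].
Qed.

Lemma E_nablaP P Q :
  E_nabla (P, Q) <-> forall x, pf_set P (nabla x) <-> pf_set Q (nabla x).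
Proof.
split=> [PQ x|PQ]; last first.
  by apply/seteqP; split=> k [Pk [x _ e]]; subst k; split;
    (exact/PQ || exists x).
have rx : range (@nabla d L) (nabla x) by exists x.
have /seteqP[sPQ sQP] : (pf_set P `&` range (@nabla d L) =
    pf_set Q `&` range (@nabla d L))%classic by [].
by split=> [Px|Qx]; [have [] := sPQ (nabla x) | have [] := sQP (nabla x)].
Qed.

Lemma E_nabla_triangle P Q x :
  E_nabla (P, Q) -> pf_set P (triangle x) <-> pf_set Q (triangle x).
Proof. by move=> /E_nablaP/(_ (triangle x)); rewrite nabla_triangle. Qed.

Lemma E_nabla_tighten P Q :
  (forall x, pf_set P (triangle x) -> pf_set Q x) ->
  (forall x, pf_set Q x -> pf_set P (nabla x)) -> E_nabla (P, Q).
Proof.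
move=> PQ QP; apply/E_nablaP => x; split=> [Px|/QP]; last first.
  by rewrite nabla_nabla.
by apply: PQ; rewrite triangle_nabla.
Qed.

Lemma rel_img1P P Q : rel_img (@E_nabla d L) [set P] Q <-> E_nabla (P, Q).
Proof. by split=> [[_ ->]//|PQ]; exists P. Qed.

(** The filter generated by [G] and the elements whose [triangle] is in [Q] avoids the ideal of
    [nabla_ideal Q], because [nabla] passes through a meet with [triangle b]. A proper extension of
    the maximal [P] meets that ideal, so its trace differs from that of [Q]. *)
Lemma max_E_nabla_extension (G : set L) Q : lattice_filter G ->
  (forall x, G x -> pf_set Q (nabla x)) ->
  exists2 P, G `<=` pf_set P & max_elts (rel_img (@E_nabla d L) [set Q]) P.
Proof.
move=> fG GQ.
have [||x [a [b [Ga /= Qb abx]]]|P [GP P0 Pmax]] := @maximal_prime_filter _ L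
  (filter_join G [set x | pf_set Q (triangle x)])
  [set x | ~ pf_set Q (nabla x)].
- exact: filter_join_filter (triangle_filter Q).
- exact: nabla_ideal.
- apply; apply: (@pfW _ _ Q (nabla (a `&` triangle b))).
    by apply: nabla_mono; apply: le_trans abx; rewrite leI2 ?triangle_le.
  by rewrite nabla_meet_triangle; apply/pfI; split=> //; apply: GQ.
have QP x : pf_set Q (triangle x) -> pf_set P x.
  by move=> Qx; apply: GP; apply: filter_join_subr.
exists P; first by move=> x Gx; apply/GP/filter_join_subl/Gx/triangle_filter.
split=> [|T /rel_img1P /E_nablaP QT /pf_leP PT].
  by apply/rel_img1P/E_nabla_tighten => // x /P0/contrapT.
apply/primeFilter_inj/seteqP; split=> // x Tx.
apply: contrapT => /Pmax[p Pp]; apply; apply/QT.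
by apply: pfW (nabla_ge _) _; apply/pfI; split=> //; apply: PT.
Qed.

(** For the converse, the [nabla] of each element of [P] is in [Q], so [P] extends to a prime filter
    equivalent to [Q]. *)
Lemma rel_img_upsetP P Q : rel_img (@E_nabla d L) (upset P) Q <->
  forall x, pf_set P (triangle x) -> pf_set Q x.
Proof.
split=> [[T /pf_leP PT TQ] x Px|PQ].
  by apply: pfW (triangle_le x) _; apply/(E_nabla_triangle x TQ)/PT.
have [|x Px|T PT [/rel_img1P/E_nablaP QT _]] :=
    @max_E_nabla_extension (pf_set P) Q.
- exact: pf_filter.
- by apply: PQ; rewrite triangle_nabla; apply: pfW Px; apply: nabla_ge.
- by exists T; [apply/pf_leP | apply/E_nablaP => x; split=> /QT].
Qed.

(** Turns maximality into an algebraic witness. Without one, the filter generated by [Q] and [b]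
    would extend within the class of [P], and maximality would put [b] in [Q]. *)
Lemma max_E_nablaP P Q :
  max_elts (rel_img (@E_nabla d L) [set P]) Q ->
  E_nabla (P, Q) /\
  forall b, ~ pf_set Q b ->
    exists2 q, pf_set Q q & ~ pf_set P (nabla (q `&` b)).
Proof.
move=> [/rel_img1P PQ Qmax]; split=> // b nQb; apply: contrapT => nex.
have [||T QbT maxT] := @max_E_nabla_extension
    (filter_join (pf_set Q) [set x | b <= x]) P.
- by apply: filter_join_filter; [exact: pf_filter | exact: principal_filter].
- move=> x [q [c [Qq bc qcx]]]; apply: contrapT => nPx; apply: nex.
  exists q => // Pqb; apply: nPx; apply: pfW Pqb; apply: nabla_mono.
  by apply: le_trans qcx; rewrite leI2.
have QT : pf_set Q `<=` pf_set T.
  by move=> x Qx; apply/QbT/filter_join_subl/Qx/principal_filter.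
have TQ : T = Q by apply: Qmax; [case: maxT | apply/pf_leP].
apply: nQb; rewrite -TQ; apply: QbT; apply: filter_join_subr.
  exact: pf_filter.
exact: lexx.
Qed.

(** By [rel_img_upsetP] the minimum is sought among all prime filters containing a fixed filter,
    which is the setting of [minimal_prime_filter]. *)
Lemma min_E_nabla_extension (J : set L) P : lattice_ideal J ->
  (forall x, J x -> ~ pf_set P (triangle x)) ->
  exists2 Q, forall x, J x -> ~ pf_set Q x
    & min_elts (rel_img (@E_nabla d L) (upset P)) Q.
Proof.
move=> iJ JP.
have [||x Px Jx|Q [PQ Q0 Qmin]] := @minimal_prime_filter _ L
  [set x | pf_set P (triangle x)] J.
- exact: triangle_filter.
- exact: iJ.
- exact: JP Px.
exists Q; first by move=> x Jx Qx; apply: Q0 Jx.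
split=> [|T /rel_img_upsetP PT /pf_leP TQ]; first exact/rel_img_upsetP.
apply/primeFilter_inj/seteqP; split=> // x /Qmin[r nQr /PT/pfU[]//].
by move=> /TQ.
Qed.

Lemma ideal_join_principal (J : set L) a : lattice_ideal J ->
  lattice_ideal [set x | exists2 r, J r & x <= r `|` a].
Proof.
move=> [J0 Jdown JU]; split.
- by exists \bot => //; rewrite le0x.
- by move=> x y [r Jr yra] xy; exists r => //; apply: le_trans yra.
- move=> x y [r Jr xra] [s Js ysa]; exists (r `|` s); first exact: JU.
  by rewrite leUx -[a]joinxx joinACA (le_trans xra) ?leUl ?(le_trans ysa) ?leUr.
Qed.

Lemma pfC_ideal P : lattice_ideal [set x | ~ pf_set P x].
Proof.
split=> [|a b /= nPb ab Pa|a b /= nPa nPb /pfU[]//]; first exact: pf0.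
by apply: nPb; apply: pfW Pa.
Qed.

(** Dual to [max_E_nablaP], with the ideal generated by [a] and the complement of [Q]. *)
Lemma min_E_nablaP P Q :
  min_elts (rel_img (@E_nabla d L) (upset P)) Q ->
  (forall x, pf_set P (triangle x) -> pf_set Q x) /\
  forall a, pf_set Q a ->
    exists2 r, ~ pf_set Q r & pf_set P (triangle (r `|` a)).
Proof.
move=> [/rel_img_upsetP PQ Qmin]; split=> // a Qa; apply: contrapT => nex.
have [||T QaT minT] := @min_E_nabla_extension
    [set x | exists2 r, ~ pf_set Q r & x <= r `|` a] P.
- exact: (ideal_join_principal a (pfC_ideal Q)).
- move=> x [r nQr xra] Px; apply: nex; exists r => //.
  by apply: pfW Px; apply: triangle_mono.
have TQ : T = Q.
  apply: Qmin; first by case: minT.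
  apply/pf_leP => x Tx; apply: contrapT => nQx; apply: QaT Tx.
  by exists x => //; rewrite leUl.
apply: (QaT a); last by rewrite TQ.
by exists \bot; [exact: pf0 | rewrite leUr].
Qed.

Lemma nabla_maxP P a : pf_set P (nabla a) ->
  exists2 Q, max_elts (rel_img (@E_nabla d L) [set P]) Q & pf_set Q a.
Proof.
move=> Pa; have [||Q aQ maxQ] := @max_E_nabla_extension [set x | a <= x] P.
- exact: principal_filter.
- by move=> x ax; apply: pfW Pa; apply: nabla_mono.
- by exists Q => //; apply: aQ; exact: lexx.
Qed.

Lemma triangle_minP P a : ~ pf_set P (triangle a) ->
  exists2 Q, min_elts (rel_img (@E_nabla d L) (upset P)) Q & ~ pf_set Q a.
Proof.
move=> nPa; have [||Q aQ minQ] := @min_E_nabla_extension [set x | x <= a] P.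
- exact: principal_ideal.
- by move=> x xa Px; apply: nPa; apply: pfW Px; apply: triangle_mono.
- by exists Q => //; apply: aQ; exact: lexx.
Qed.

(** * Closed sets of prime filters versus congruences *)

Section Theta.
Implicit Types (Y Z : set X) (R : set (L * L)).

Lemma Theta_MP Y a b : Theta_M Y (a, b) <->
  forall P, Y P -> pf_set P a <-> pf_set P b.
Proof.
split=> [ab P YP|ab]; last first.
  by apply/seteqP; split=> P [/= Pa YP]; split=> //; apply/ab.
have /seteqP[sab sba] : (sigma a `&` Y = sigma b `&` Y)%classic by [].
by split=> [Pa|Pb]; [have [] := sab P | have [] := sba P].
Qed.

Lemma Theta_M_sub Y Z : Y `<=` Z -> Theta_M Z `<=` Theta_M Y.
Proof.
by move=> YZ [a b] /Theta_MP ab; apply/Theta_MP => P /YZ; apply: ab.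
Qed.

(** A point of [Z] outside [Y] would separate a pair $(a, a \wedge b)$ that [Y] identifies. *)
Lemma Theta_M_sub_closed Y Z : closed Y ->
  Theta_M Y `<=` Theta_M Z -> Z `<=` Y.
Proof.
move=> cY YZ Q ZQ; apply: contrapT.
move=> /(closed_separation cY)[a [b [Qa nQb ab]]].
have : Theta_M Z (a, a `&` b).
  apply: YZ; apply/Theta_MP => P YP; split=> [Pa|/pfI[]//].
  by apply/pfI; split=> //; apply: ab.
by move=> /Theta_MP/(_ _ ZQ)[/(_ Qa)/pfI[]].
Qed.

(** Compatibility with [nabla] and [triangle] at [P] reduces to the pair itself at an extremal [Q],
    which saturation puts in [Y]. *)
Lemma id_saturated_congruence Y :
  id_saturated Y -> is_m_congruence (Theta_M Y).
Proof.
move=> sY.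
have nab a b P : Theta_M Y (a, b) -> Y P -> pf_set P (nabla a) ->
    pf_set P (nabla b).
  move=> /Theta_MP ab YP /nabla_maxP[Q maxQ Qa].
  have YQ : Y Q by apply: (sY P) => //; right.
  have [/E_nablaP PQ _] := max_E_nablaP maxQ.
  by apply/PQ; apply: pfW (nabla_ge b) _; apply/ab.
have tri a b P : Theta_M Y (a, b) -> Y P -> pf_set P (triangle a) ->
    pf_set P (triangle b).
  move=> /Theta_MP ab YP Pa; apply: contrapT => /triangle_minP[Q minQ]; apply.
  have YQ : Y Q by apply: (sY P) => //; left.
  have [PQ _] := min_E_nablaP minQ.
  by apply/ab => //; apply: PQ.
have sym a b : Theta_M Y (a, b) -> Theta_M Y (b, a).
  by move=> /Theta_MP ab; apply/Theta_MP => P /ab[].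
split; [split=> //| | | |].
- by move=> a b c /Theta_MP ab /Theta_MP bc; apply/Theta_MP => P YP;
    split=> [/(ab _ YP)/(bc _ YP)|/(bc _ YP)/(ab _ YP)].
- move=> a b a' b' /Theta_MP ab /Theta_MP ab'; apply/Theta_MP => P YP.
  by split=> /pfI[/(ab _ YP) ? /(ab' _ YP) ?]; apply/pfI.
- move=> a b a' b' /Theta_MP ab /Theta_MP ab'; apply/Theta_MP => P YP.
  by split=> /pfU[/(ab _ YP)|/(ab' _ YP)] ?; apply/pfU; [left|right|left|right].
- move=> a b ab; apply/Theta_MP => P YP.
  by split; apply: tri => //; apply: sym.
- move=> a b ab; apply/Theta_MP => P YP.
  by split; apply: nab => //; apply: sym.
Qed.

Lemma congruence_id_saturated Y :
  closed Y -> is_m_congruence (Theta_M Y) -> id_saturated Y.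
Proof.
move=> cY [_ _ _ tri nab] P YP Q minmaxQ.
apply: contrapT => /(closed_separation cY)[a [b [Qa nQb ab]]].
case: minmaxQ => [/min_E_nablaP[PQ Qmin]|/max_E_nablaP[/E_nablaP PQ Qmax]].
- have [r nQr Pra] := Qmin _ Qa.
  (* On [Y], [a] implies [b], so joining [a] changes nothing; but the [triangle] of the larger side
     is in [P], which forces [r] or [b] into [Q]. *)
  have /tri/Theta_MP/(_ _ YP)[_ h] : Theta_M Y (r `|` b, (r `|` b) `|` a).
    apply/Theta_MP => T YT; split=> [?|/pfU[//|/(ab _ YT) ?]].
    + by apply/pfU; left.
    + by apply/pfU; right.
  have /PQ/pfU[]// : pf_set P (triangle (r `|` b)).
  by apply: h; apply: pfW Pra; apply: triangle_mono; rewrite leU2 ?leUl.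
- have [q Qq nPqb] := Qmax _ nQb.
  (* Meeting with [b] changes nothing on [Y], yet [P] contains the [nabla] of $q \wedge a$ and not
     that of $q \wedge b$. *)
  have /nab/Theta_MP/(_ _ YP)[h _] : Theta_M Y (q `&` a, (q `&` a) `&` b).
    apply/Theta_MP => T YT; split=> [/[dup]? /pfI[_ /(ab _ YT) ?]|/pfI[]//].
    exact/pfI.
  apply: nPqb; have : pf_set P (nabla (q `&` a)).
    by apply/PQ; apply: pfW (nabla_ge _) _; apply/pfI.
  by move=> /h; apply: pfW; apply: nabla_mono; rewrite leI2 ?leIl.
Qed.

(** For a congruence [R], these are the preimages of the prime filters of the quotient by [R]. *)
Definition stable_filters R : set X :=
  [set P | forall a b, R (a, b) -> pf_set P a -> pf_set P b].

Lemma closed_stable_filters R : closed (stable_filters R).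
Proof.
have -> : stable_filters R =
    \bigcap_(ab in R) (~` sigma ab.1 `|` sigma ab.2)%classic.
  apply/seteqP; split=> [P PR [a b] Rab|P PR a b Rab Pa].
    by have [/(PR _ _ Rab)|] := pselect (pf_set P a); [right|left].
  by have [] := PR _ Rab.
apply: closed_bigI => -[a b] _; apply: closedU.
- exact: closed_sigmaC.
- exact: closed_sigma.
Qed.

(** The ideal used consists of the elements whose class is below that of [b]. It is a union of
    classes, so a filter containing [a] and maximal for avoiding it is stable under [R], and it
    omits [b]. *)
Lemma Theta_M_stable_filters R : is_m_congruence R ->
  Theta_M (stable_filters R) = R.
Proof.
move=> [[Rr Rs Rt] RI RU _ _]; apply/seteqP; split=> -[a b]; last first.
  move=> Rab; apply/Theta_MP => P PR.
  by split; apply: PR => //; apply: Rs.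
move=> /Theta_MP; wlog suff main : a b / (forall P, stable_filters R P ->
    pf_set P a -> pf_set P b) -> R (a, a `&` b).
  move=> ab; apply: (Rt _ (a `&` b)).
    by apply: main => P PR /(ab _ PR).
  by rewrite meetC; apply/Rs/main => P PR /(ab _ PR).
move=> ab; apply: contrapT => nR.
have [||x /= ax Rx|P [aP P0 Pmax]] := @maximal_prime_filter _ L
    [set x | a <= x] [set x | R (x `|` b, b)].
- exact: principal_filter.
- split=> /= [|x y Ry xy|x y Rx Ry]; first by rewrite join0x.
  + have := RI _ _ _ _ (Rr (x `|` b)) Ry.
    by rewrite (meet_idPl (leU2 xy (lexx b))) (meet_idPr (leUr _ _)).
  + by rewrite -[b]joinxx joinACA; apply: RU.
- apply: nR.
  (* Since $a \le x$, meeting [Rx] with [a] relates [a] to $a \wedge b$. *)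
  have := RI _ _ _ _ (Rr a) Rx.
  by rewrite (meet_idPl _) // (le_trans ax) // leUl.
apply: (P0 b); last by rewrite /= joinxx.
apply: ab; last by apply: aP; exact: lexx.
move=> x y Rxy Px; apply: contrapT => /Pmax[p Pp Rpy].
apply: (P0 (p `&` x)); first exact/pfI.
by apply: Rt Rpy; apply: RU => //; apply: RI.
Qed.

End Theta.

End MLatticeTheory.

Theorem theorem2p2 (d : Order.disp_t) (L : mLatticeType d) :
  exists f : closedIdSat L -> (mCongruence L)^d%type,
    [/\ forall Y : closedIdSat L,
          mcong_set (f Y : mCongruence L) = Theta_M (cis_set Y),
        bijective f,
        {morph f : Y Z / Order.meet Y Z >-> Order.meet Y Z}
      & {morph f : Y Z / Order.join Y Z >-> Order.join Y Z}].
Proof.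
pose f (Y : closedIdSat L) : (mCongruence L)^d%type :=
  MCongruence (id_saturated_congruence (cis_prop Y).2).
have gP (R : mCongruence L) :
    closed (stable_filters R) /\ id_saturated (stable_filters R).
  have cR : closed (stable_filters R) by exact: closed_stable_filters.
  split=> //.
  apply: congruence_id_saturated => //.
  by rewrite Theta_M_stable_filters; exact: mcong_prop.
pose g (R : (mCongruence L)^d%type) : closedIdSat L := ClosedIdSat (gP R).
have fbij : bijective f.
  exists g => [Y|R]; last first.
    by apply/mCongruence_inj/Theta_M_stable_filters/mcong_prop.
  (* Two closed sets with the same [Theta_M] contain each other. *)
  have e : Theta_M (stable_filters (f Y)) = Theta_M Y.
    exact/Theta_M_stable_filters/mcong_prop.
  have [cY _] := cis_prop Y; have [cgY _] := gP (f Y).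
  by apply/closedIdSat_inj/seteqP; split; apply: Theta_M_sub_closed;
    rewrite ?e.
(* The codomain carries the reversed order, so the antitone [Theta_M] becomes monotone. *)
have fle : {mono f : Y Z / Y <= Z}.
  move=> Y Z; apply/asboolP/asboolP; last exact: Theta_M_sub.
  by apply: Theta_M_sub_closed; have [] := cis_prop Z.
exists f; split=> //; first exact: bij_mono_morph_meet.
exact: bij_mono_morph_join.
Qed.
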